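(* Let $A\in\mathbb{H}^{N\times N}$ be a hermitian quaternion matrix with eigenvalues $|\lambda_1|>|\lambda_2|\ge\dots\ge|\lambda_N|$. Let $U_1,\dots,U_N$ be a right-eigenbase of $\mathbb{H}^N$ associated to $A$. Let $X_0=\sum_{i=1}^N U_i a_i$ be a vector in $\mathbb{H}^N$ with $a_1\ne 0$. Then the sequence defined by $X_{k+1}=A X_k$ satisfies $\|X_{k+1}\|/\|X_k\|\to\lambda_1$, and $X_k$ tends to an eigenvector of $A$ associated to $\lambda_1$, when $k\to+\infty$.
   Context: $\mathbb{H}$ denotes the quaternions, with conjugation $q\mapsto\overline q$ and Euclidean norm $|q|_2=(q\overline q)^{1/2}$. $\mathbb{H}^{N\times N}$ is the set of $N\times N$ quaternion matrices; $A$ is hermitian if $A=A^*$, where $*$ is conjugate transposition. Eigenvalues are right eigenvalues: an eigenvector of $A$ associated to $\lambda$ is a nonzero $V\in\mathbb{H}^N$ with $AV=V\lambda$. A hermitian quaternion matrix has only real right eigenvalues and is diagonalisable in an orthonormal basis. The eigenvalues $\lambda_1,\dots,\lambda_N$ are listed with multiplicity. A right-eigenbase associated to $A$ is a basis $U_1,\dots,U_N$ of $\mathbb{H}^N$ (with scalars acting on the right) with $AU_i=U_i\lambda_i$ for each $i$; the coefficients $a_i$ are quaternions. $\|\cdot\|$ is the Euclidean norm on $\mathbb{H}^N$, $\|X\|=(\sum_i |x_i|_2^2)^{1/2}$.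
   Formalization: The norm ratio limit is stated as |λ_1| (the printed λ_1 fails if λ_1<0), and ''X_k tends to an eigenvector'' is stated up to scaling: λ_1^{-k}X_k→V and sgn(λ_1)^k X_k/‖X_k‖→V/‖V‖ with V an eigenvector for λ_1, as X_k itself converges to one only if λ_1=1. *)

(* Defs.v *)
(* MathComp / MathComp-Analysis. *)
From HB Require Import structures.
From mathcomp Require Import all_boot all_order all_algebra.
From mathcomp Require Import ring.
From mathcomp Require Import boolp classical_sets reals topology normedtype.
From mathcomp Require Import sequences.

Set Implicit Arguments.
Unset Strict Implicit.
Unset Printing Implicit Defensive.

Import Order.TTheory GRing.Theory Num.Theory.
Import numFieldNormedType.Exports.
Local Open Scope ring_scope.

Record quat (R : Type) := Quat { quatr : R; quati : R; quatj : R; quatk : R }.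

Section QuatChoice.
Variable R : choiceType.

Definition tuple_of_quat (q : quat R) : R * R * R * R :=
  (quatr q, quati q, quatj q, quatk q).
Definition quat_of_tuple (t : R * R * R * R) : quat R :=
  let: (a, b, c, d) := t in Quat a b c d.
Lemma tuple_of_quatK : cancel tuple_of_quat quat_of_tuple.
Proof. by case. Qed.

HB.instance Definition _ := Choice.copy (quat R) (can_type tuple_of_quatK).
End QuatChoice.

Section QuatRing.
Variable R : comNzRingType.
Implicit Types p q r : quat R.

Definition quat_add p q :=
  Quat (quatr p + quatr q) (quati p + quati q)
       (quatj p + quatj q) (quatk p + quatk q).
Definition quat_opp q := Quat (- quatr q) (- quati q) (- quatj q) (- quatk q).
Definition quat_of (x : R) : quat R := Quat x 0 0 0.

(* Hamilton's product: i^2 = j^2 = k^2 = ijk = -1. *)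
Definition quat_mul p q :=
  let: Quat a b c d := p in let: Quat a' b' c' d' := q in
  Quat (a * a' - b * b' - c * c' - d * d')
       (a * b' + b * a' + c * d' - d * c')
       (a * c' - b * d' + c * a' + d * b')
       (a * d' + b * c' - c * b' + d * a').

Definition quat_conj q := Quat (quatr q) (- quati q) (- quatj q) (- quatk q).

Lemma quat_addA : associative quat_add.
Proof. by move=> p q r; rewrite /quat_add /= !addrA. Qed.
Lemma quat_addC : commutative quat_add.
Proof. by move=> p q; congr Quat; rewrite addrC. Qed.
Lemma quat_add0q : left_id (quat_of 0) quat_add.
Proof. by case=> *; rewrite /quat_add /= !add0r. Qed.
Lemma quat_addNq : left_inverse (quat_of 0) quat_opp quat_add.
Proof. by case=> *; rewrite /quat_add /= !addNr. Qed.

HB.instance Definition _ :=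
  GRing.isZmodule.Build (quat R) quat_addA quat_addC quat_add0q quat_addNq.

Lemma quat_mulA : associative quat_mul.
Proof. by case=> ????; case=> ????; case=> ????; congr Quat => /=; ring. Qed.
Lemma quat_mul1q : left_id (quat_of 1) quat_mul.
Proof. by case=> ????; congr Quat => /=; ring. Qed.
Lemma quat_mul1 : right_id (quat_of 1) quat_mul.
Proof. by case=> ????; congr Quat => /=; ring. Qed.
Lemma quat_mulDl : left_distributive quat_mul quat_add.
Proof. by case=> ????; case=> ????; case=> ????; congr Quat => /=; ring. Qed.
Lemma quat_mulDr : right_distributive quat_mul quat_add.
Proof. by case=> ????; case=> ????; case=> ????; congr Quat => /=; ring. Qed.
Lemma quat_one_neq0 : quat_of 1 != 0.
Proof. by apply/eqP => -[/eqP]; rewrite oner_eq0. Qed.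

HB.instance Definition _ := GRing.Zmodule_isNzRing.Build (quat R)
  quat_mulA quat_mul1q quat_mul1 quat_mulDl quat_mulDr quat_one_neq0.

Lemma quat_mul_conj q : q * quat_conj q =
  quat_of (quatr q ^+ 2 + quati q ^+ 2 + quatj q ^+ 2 + quatk q ^+ 2).
Proof. by case: q => a b c d; congr Quat => /=; ring. Qed.
End QuatRing.

Section QuatMatrix.
Variable R : comNzRingType.

Definition adjmx m n (A : 'M[quat R]_(m, n)) : 'M[quat R]_(n, m) :=
  map_mx (@quat_conj R) A^T.

Definition quat_hermitian n (A : 'M[quat R]_n) : Prop := A = adjmx A.

(* Scalars act on the right, whereas *: is the action on the left. *)
Definition rscale n (V : 'cV[quat R]_n) (q : quat R) : 'cV[quat R]_n :=
  \col_i (V i 0 * q).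

Definition right_eigenvector n (A : 'M[quat R]_n) (l : quat R)
    (V : 'cV[quat R]_n) : Prop :=
  V != 0 /\ A *m V = rscale V l.

Definition right_free m n (U : 'I_m -> 'cV[quat R]_n) : Prop :=
  forall c : 'I_m -> quat R,
    \sum_i rscale (U i) (c i) = 0 -> forall i, c i = 0.

Definition right_spanning m n (U : 'I_m -> 'cV[quat R]_n) : Prop :=
  forall V : 'cV[quat R]_n,
    exists c : 'I_m -> quat R, V = \sum_i rscale (U i) (c i).

Definition right_basis m n (U : 'I_m -> 'cV[quat R]_n) : Prop :=
  right_free U /\ right_spanning U.

(* The eigenvalues are taken in R since a hermitian quaternion matrix has only
   real right eigenvalues.  As U is a basis of eigenvectors, l lists all the
   eigenvalues of A with multiplicity. *)
Definition right_eigenbase n (A : 'M[quat R]_n) (l : 'I_n -> R)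
    (U : 'I_n -> 'cV[quat R]_n) : Prop :=
  right_basis U /\ forall i, A *m U i = rscale (U i) (quat_of (l i)).
End QuatMatrix.

Section QuatNorm.
Variable R : realType.

(* q * quat_conj q is real by quat_mul_conj, so quatr loses nothing. *)
Definition quat_abs (q : quat R) : R := Num.sqrt (quatr (q * quat_conj q)).

Definition vnorm n (V : 'cV[quat R]_n) : R :=
  Num.sqrt (\sum_i quat_abs (V i 0) ^+ 2).

Definition tendsto n (X : nat -> 'cV[quat R]_n) (V : 'cV[quat R]_n) : Prop :=
  (vnorm (X k - V) @[k --> \oo] --> (0 : R))%classic.
End QuatNorm.

(* Main.v *)
(* Since the eigenvalues are real, lambda_1^-k X_k is the sum of the U_i a_i
   weighted by the real scalars (lambda_i / lambda_1)^k, which tend to 0 for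
   i > 1; hence it tends to V = U_1 a_1, an eigenvector because real quaternions
   are central and nonzero because the U_i are free.  Convergence is handled
   on real coordinates, so that continuity of the norm gives both the limit of
   the ratios and that of the normalised sequence. *)
Require Import Defs.
From HB Require Import structures.
From mathcomp Require Import all_boot all_order all_algebra.
From mathcomp Require Import ring.
From mathcomp Require Import boolp classical_sets reals topology normedtype.
From mathcomp Require Import sequences realfun.

Set Implicit Arguments.
Unset Strict Implicit.
Unset Printing Implicit Defensive.

Import Order.TTheory GRing.Theory Num.Theory.
Import numFieldNormedType.Exports.
Local Open Scope classical_set_scope.
Local Open Scope ring_scope.

(** * Right multiplication by real scalars *)

Section RealScaling.
Variable R : comNzRingType.

Lemma quat_mul_ofr (q : quat R) (x : R) :
  q * quat_of x = Quat (quatr q * x) (quati q * x) (quatj q * x) (quatk q * x).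
Proof. by case: q => a b c d; congr Quat => /=; ring. Qed.

Lemma quat_ofC (q : quat R) (x : R) : quat_of x * q = q * quat_of x.
Proof. by case: q => a b c d; congr Quat => /=; ring. Qed.

Lemma quat_ofM (x y : R) : quat_of x * quat_of y = quat_of (x * y).
Proof. by congr Quat => /=; ring. Qed.

Lemma rscaleA n (V : 'cV[quat R]_n) p q :
  rscale (rscale V p) q = rscale V (p * q).
Proof. by apply/colP => i; rewrite !mxE mulrA. Qed.

Lemma rscaleq1 n (V : 'cV[quat R]_n) : rscale V 1 = V.
Proof. by apply/colP => i; rewrite !mxE mulr1. Qed.

Lemma rscaleq0 n (V : 'cV[quat R]_n) : rscale V 0 = 0.
Proof. by apply/colP => i; rewrite !mxE mulr0. Qed.

Lemma rscale_suml n I (r : seq I) (F : I -> 'cV[quat R]_n) q :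
  rscale (\sum_(i <- r) F i) q = \sum_(i <- r) rscale (F i) q.
Proof.
apply/colP => i; rewrite mxE !summxE mulr_suml.
by apply: eq_bigr => j _; rewrite mxE.
Qed.

Lemma mulmx_rscale m n (A : 'M[quat R]_(m, n)) (V : 'cV[quat R]_n) q :
  A *m rscale V q = rscale (A *m V) q.
Proof.
apply/colP => i; rewrite !mxE mulr_suml.
by apply: eq_bigr => j _; rewrite mxE mulrA.
Qed.

(** Freeness is applied to the coefficients equal to [q] at [i] and 0 elsewhere. This is how $a_1
    \ne 0$ makes the limit vector nonzero. *)
Lemma right_free_neq0 m n (U : 'I_m -> 'cV[quat R]_n) i q :
  right_free U -> q != 0 -> rscale (U i) q != 0.
Proof.
move=> U_free; apply: contra_neq => Uq0.
have := U_free (fun j => if j == i then q else 0) _ i; rewrite eqxx; apply.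
rewrite (bigD1 i) //= eqxx Uq0 add0r big1 // => j /negPf ->.
exact: rscaleq0.
Qed.

(** Scaling by a nonzero [q] turns a right eigenvalue $\lambda$ into $q^{-1}\lambda q$, which is
    $\lambda$ again when $\lambda$ is real, hence central. *)
Lemma right_eigen_rscale n (A : 'M[quat R]_n) (V : 'cV[quat R]_n) (l : R) q :
  A *m V = rscale V (quat_of l) ->
  A *m rscale V q = rscale (rscale V q) (quat_of l).
Proof. by move=> AV; rewrite mulmx_rscale AV !rscaleA quat_ofC. Qed.

(** The quaternion coefficients are absorbed into the eigenvectors [W i], so that each step only
    multiplies every term by a real scalar. *)
Lemma power_iterates n (A : 'M[quat R]_n) m (l : 'I_m -> R)
    (W : 'I_m -> 'cV[quat R]_n) (X : nat -> 'cV[quat R]_n) :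
  (forall i, A *m W i = rscale (W i) (quat_of (l i))) ->
  X 0%N = \sum_i W i -> (forall k, X k.+1 = A *m X k) ->
  forall k, X k = \sum_i rscale (W i) (quat_of (l i ^+ k)).
Proof.
move=> AW X0 XS; elim=> [|k IHk].
  by rewrite X0; apply: eq_bigr => i _; rewrite expr0 rscaleq1.
rewrite XS IHk mulmx_sumr; apply: eq_bigr => i _.
by rewrite mulmx_rscale AW rscaleA quat_ofM exprS.
Qed.

End RealScaling.

(** * Real coordinates of quaternions *)

Section Coordinates.
Variable R : comNzRingType.

(** Indexing the coordinates by ['I_4] makes the squared norm a double sum and treats the four
    components uniformly. *)
Definition quat_coord (j : 'I_4) (q : quat R) : R :=
  tnth [tuple quatr q; quati q; quatj q; quatk q] j.

Lemma quat_coordD j p q : quat_coord j (p + q) = quat_coord j p + quat_coord j q.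
Proof. by case: j => [[|[|[|[|?]]]] ?]. Qed.

Lemma quat_coordN j q : quat_coord j (- q) = - quat_coord j q.
Proof. by case: j => [[|[|[|[|?]]]] ?]. Qed.

Lemma quat_coordB j p q : quat_coord j (p - q) = quat_coord j p - quat_coord j q.
Proof. by rewrite quat_coordD quat_coordN. Qed.

Lemma quat_coord0 j : quat_coord j 0 = 0.
Proof. by case: j => [[|[|[|[|?]]]] ?]. Qed.

Lemma quat_coord_sum j I (r : seq I) (F : I -> quat R) :
  quat_coord j (\sum_(i <- r) F i) = \sum_(i <- r) quat_coord j (F i).
Proof. exact: (big_morph _ (quat_coordD j) (quat_coord0 j)). Qed.

Lemma quat_coordZ j q x : quat_coord j (q * quat_of x) = quat_coord j q * x.
Proof. by rewrite quat_mul_ofr; case: j => [[|[|[|[|?]]]] ?]. Qed.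

Lemma quat_coord_inj p q : (forall j, quat_coord j p = quat_coord j q) -> p = q.
Proof.
case: p q => a b c d [a' b' c' d'] pq; congr Quat.
- exact: (pq (@Ordinal 4 0 isT)).
- exact: (pq (@Ordinal 4 1 isT)).
- exact: (pq (@Ordinal 4 2 isT)).
- exact: (pq (@Ordinal 4 3 isT)).
Qed.

End Coordinates.

(** * The norm and coordinatewise convergence *)

Section Norm.
Variable R : realType.

Lemma quat_abs_sqr (q : quat R) :
  quat_abs q ^+ 2 = \sum_j quat_coord j q ^+ 2.
Proof.
rewrite /quat_abs quat_mul_conj /= sqr_sqrtr ?addr_ge0 ?sqr_ge0 //.
by rewrite !big_ord_recr big_ord0 /= add0r.
Qed.

Lemma vnormE n (V : 'cV[quat R]_n) :
  vnorm V = Num.sqrt (\sum_i \sum_j quat_coord j (V i 0) ^+ 2).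
Proof. by congr Num.sqrt; apply: eq_bigr => i _; exact: quat_abs_sqr. Qed.

Lemma vnorm0 n : vnorm (0 : 'cV[quat R]_n) = 0.
Proof.
rewrite vnormE big1 ?sqrtr0 // => i _; rewrite big1 // => j _.
by rewrite mxE quat_coord0 expr0n.
Qed.

Lemma vnorm_eq0 n (V : 'cV[quat R]_n) : vnorm V = 0 -> V = 0.
Proof.
have ge0 i : 0 <= \sum_j quat_coord j (V i 0) ^+ 2.
  by apply: sumr_ge0 => j _; exact: sqr_ge0.
rewrite vnormE => /eqP; rewrite sqrtr_eq0 => le0.
have /eqP : \sum_i \sum_j quat_coord j (V i 0) ^+ 2 == 0.
  by rewrite eq_le le0 sumr_ge0.
move/psumr_eq0P => sum0.
apply/colP => i; apply: quat_coord_inj => j.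
rewrite mxE quat_coord0; apply/eqP; rewrite -sqrf_eq0; apply/eqP.
(* A vanishing sum of nonnegative terms is used twice: over the entries, then over the four
   coordinates of an entry. *)
by apply: (psumr_eq0P _ (sum0 _ i isT)) => // *; exact: sqr_ge0.
Qed.

Lemma vnorm_rscale n (V : 'cV[quat R]_n) (x : R) :
  vnorm (rscale V (quat_of x)) = `|x| * vnorm V.
Proof.
rewrite !vnormE -sqrtr_sqr -sqrtrM ?sqr_ge0 // mulr_sumr; congr Num.sqrt.
apply: eq_bigr => i _; rewrite mulr_sumr; apply: eq_bigr => j _.
by rewrite mxE quat_coordZ exprMn mulrC.
Qed.

(** Reduces limits of quaternion vectors to limits of real sequences, where the rules for sums and
    products apply. *)
Definition coord_cvg n (X : nat -> 'cV[quat R]_n) (V : 'cV[quat R]_n) : Prop :=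
  forall i j, quat_coord j (X k i 0) @[k --> \oo] --> quat_coord j (V i 0).

Lemma cvg_rsum m (u : 'I_m -> nat -> R) (l : 'I_m -> R) :
  (forall i, u i k @[k --> \oo] --> l i) ->
  \sum_i u i k @[k --> \oo] --> \sum_i l i.
Proof. by move=> ul; apply: cvg_big => //; exact: add_continuous. Qed.

(** The norm is the square root of a polynomial in the real coordinates, hence continuous. *)
Lemma cvg_vnorm n (X : nat -> 'cV[quat R]_n) V :
  coord_cvg X V -> vnorm (X k) @[k --> \oo] --> vnorm V.
Proof.
move=> XV; rewrite vnormE; under eq_fun do rewrite vnormE.
apply: continuous_cvg; first exact: sqrt_continuous.
apply: cvg_rsum => i; apply: cvg_rsum => j.
under eq_fun do rewrite expr2.
by rewrite expr2; apply: cvgM; exact: XV.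
Qed.

Lemma coord_cvg_tendsto n (X : nat -> 'cV[quat R]_n) V :
  coord_cvg X V -> tendsto X V.
Proof.
move=> XV; rewrite /tendsto -(vnorm0 n); apply: cvg_vnorm => i j.
rewrite mxE quat_coord0 -(subrr (quat_coord j (V i 0))).
under eq_fun do rewrite !mxE quat_coordB.
by apply: cvgB; [exact: XV|exact: cvg_cst].
Qed.

Lemma coord_cvg_rscale n (X : nat -> 'cV[quat R]_n) V (x : nat -> R) (l : R) :
  coord_cvg X V -> x k @[k --> \oo] --> l ->
  coord_cvg (fun k => rscale (X k) (quat_of (x k))) (rscale V (quat_of l)).
Proof.
move=> XV xl i j; rewrite mxE quat_coordZ.
under eq_fun do rewrite mxE quat_coordZ.
by apply: cvgM => //; exact: XV.
Qed.

Lemma coord_cvg_sum n m (X : 'I_m -> nat -> 'cV[quat R]_n) V :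
  (forall i, coord_cvg (X i) (V i)) ->
  coord_cvg (fun k => \sum_i X i k) (\sum_i V i).
Proof.
move=> XV i j; rewrite summxE quat_coord_sum.
under eq_fun do rewrite summxE quat_coord_sum.
by apply: cvg_rsum => h; exact: XV.
Qed.

(** The weight of index [ord0] is constantly 1; every other weight is a power of a ratio of modulus
    less than 1 and tends to 0. *)
Lemma dominant_term_cvg n m (W : 'I_m.+1 -> 'cV[quat R]_n) (l : 'I_m.+1 -> R) :
  (forall i, i != ord0 -> `|l i| < `|l ord0|) -> l ord0 != 0 ->
  coord_cvg (fun k => \sum_i rscale (W i) (quat_of ((l i / l ord0) ^+ k)))
    (W ord0).
Proof.
move=> lt_l l0.
(* The limit is written as a sum with Kronecker weights so that limits can be taken term by term. *)
have -> : W ord0 = \sum_i rscale (W i) (quat_of (i == ord0)%:R).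
  rewrite (bigD1 ord0) //= rscaleq1 big1 ?addr0 // => i /negPf ->.
  exact: rscaleq0.
apply: coord_cvg_sum => i; apply: coord_cvg_rscale; first by move=> *; exact: cvg_cst.
have [->|i0] := eqVneq i ord0.
  by under eq_fun do rewrite divff // expr1n; exact: cvg_cst.
by apply: cvg_expr; rewrite normrM normfV ltr_pdivrMr ?normr_gt0 // mul1r lt_l.
Qed.

End Norm.

(** A ratio of norms is nonnegative, so its limit is the modulus of $\lambda_1$. As [X k] behaves
    like $V\lambda_1^k$, convergence to an eigenvector is stated after rescaling by
    $\lambda_1^{-k}$, and also after normalisation, where the sign factor undoes the alternation
    caused by a negative $\lambda_1$. *)
Theorem theorem4 (R : realType) (n : nat) (A : 'M[quat R]_n.+2)
    (lambda : 'I_n.+2 -> R) (U : 'I_n.+2 -> 'cV[quat R]_n.+2)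
    (a : 'I_n.+2 -> quat R) (X : nat -> 'cV[quat R]_n.+2)
    (A_herm : quat_hermitian A)
    (lambda_gap : `|lambda (inord 1)| < `|lambda ord0|)
    (lambda_sorted : forall i j : 'I_n.+2,
       (0 < i)%N -> (i <= j)%N -> `|lambda j| <= `|lambda i|)
    (U_eigenbase : right_eigenbase A lambda U)
    (X0 : X 0%N = \sum_i rscale (U i) (a i))
    (a_neq0 : a ord0 != 0)
    (X_rec : forall k, X k.+1 = A *m X k) :
  vnorm (X k.+1) / vnorm (X k) @[k --> \oo] --> `|lambda ord0| /\
  exists V : 'cV[quat R]_n.+2,
    [/\ right_eigenvector A (quat_of (lambda ord0)) V,
        tendsto (fun k => rscale (X k) (quat_of (lambda ord0 ^- k))) V &
        tendsto
          (fun k => rscale (X k)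
             (quat_of (Num.sg (lambda ord0) ^+ k / vnorm (X k))))
          (rscale V (quat_of (vnorm V)^-1))].
Proof.
have [[U_free _] AU] := U_eigenbase.
pose l0 := lambda ord0.
have l0_neq0 : l0 != 0.
  by rewrite -normr_gt0; exact: le_lt_trans (normr_ge0 _) lambda_gap.
have lt_l i : i != ord0 -> `|lambda i| < `|l0|.
  move=> i0; apply: le_lt_trans lambda_gap.
  by apply: lambda_sorted; rewrite inordK // lt0n.
pose W i := rscale (U i) (a i); pose V := W ord0.
pose Y k := rscale (X k) (quat_of (l0 ^- k)).
have AW i : A *m W i = rscale (W i) (quat_of (lambda i)).
  exact: right_eigen_rscale.
have V_neq0 : V != 0 by exact: right_free_neq0.
have nV_neq0 : vnorm V != 0 by apply: contra_neq V_neq0 => /vnorm_eq0.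
have YV : coord_cvg Y V.
  suff -> : Y = fun k => \sum_i rscale (W i) (quat_of ((lambda i / l0) ^+ k)).
    exact: dominant_term_cvg.
  apply/funext => k; rewrite /Y (power_iterates AW X0 X_rec) rscale_suml.
  by apply: eq_bigr => i _; rewrite rscaleA quat_ofM exprMn exprVn.
have XY k : X k = rscale (Y k) (quat_of (l0 ^+ k)).
  by rewrite rscaleA quat_ofM mulVf ?expf_neq0 // rscaleq1.
have nX k : vnorm (X k) = `|l0| ^+ k * vnorm (Y k).
  by rewrite XY vnorm_rscale normrX.
have nl0 k : `|l0| ^+ k != 0 by rewrite expf_neq0 ?normr_eq0.
have nY := cvg_vnorm YV.
have nYS : vnorm (Y k.+1) @[k --> \oo] --> vnorm V.
  by rewrite (cvg_shiftS (fun k => vnorm (Y k))).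
have nYV : (vnorm (Y k))^-1 @[k --> \oo] --> (vnorm V)^-1 by exact: cvgV.
split.
  (* The convention $0^{-1} = 0$ makes inversion multiplicative everywhere, so the identity holds
     for every [k] with no condition on [vnorm (Y k)]. *)
  have -> : (fun k => vnorm (X k.+1) / vnorm (X k)) =
      fun k => `|l0| * (vnorm (Y k.+1) * (vnorm (Y k))^-1).
    by apply/funext => k; rewrite !nX exprS invfM mulrACA mulfK.
  (* The limit takes the form $|\lambda_1| (\|V\| / \|V\|)$, matching the product of sequences. *)
  rewrite -[X in _ --> X]mulr1 -(divff nV_neq0).
  apply: cvgM; first exact: cvg_cst.
  exact: cvgM nYS nYV.
exists V; split; [by split; last exact: AW|exact: coord_cvg_tendsto|].
apply: coord_cvg_tendsto.
(* Since $\mathrm{sg}(\lambda_1)\lambda_1 = |\lambda_1|$, the powers cancel and leave [Y k] divided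
   by its norm. *)
suff -> : (fun k => rscale (X k) (quat_of (Num.sg l0 ^+ k / vnorm (X k)))) =
    fun k => rscale (Y k) (quat_of (vnorm (Y k))^-1).
  exact: coord_cvg_rscale.
apply/funext => k; rewrite nX {1}XY rscaleA quat_ofM; congr (rscale _ (quat_of _)).
by rewrite invfM !mulrA -exprMn [l0 * _]mulrC -normrEsg divff ?mul1r.
Qed.
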